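(* For every $n \in \mathbb{N}$, let $\delta_n := d_{2n+1} - 2d_n$. Then $\delta_n = 2$ if and only if $n+1$ is divisible by $3$.
   Context: $\mathbb{N}$ denotes the positive integers. For $n \in \mathbb{N}$, the $n \times n$ grid graph $G$ is the simple graph with vertex set $\{1,\dots,n\}^2$ in which $(i,j)$ and $(i',j')$ are adjacent if and only if $|i-i'| + |j-j'| = 1$. Let $A$ be its adjacency matrix, viewed as an $n^2 \times n^2$ matrix over the field $\mathbb{Z}_2$ with two elements, and let $I$ be the identity matrix. Define $d_n = \dim_{\mathbb{Z}_2} \ker(A + I)$. *)

(* Defs.v *)
From mathcomp Require Import all_boot all_order all_algebra.

Set Implicit Arguments.
Unset Strict Implicit.
Unset Printing Implicit Defensive.

Import GRing.Theory.
Local Open Scope ring_scope.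

(* The vertex (i, j) of {1, ..., n}^2 is encoded as (i - 1, j - 1);
   [`|m - k|%N] on naturals is the absolute (not truncated) difference. *)
Definition grid_adj (n : nat) : rel ('I_n * 'I_n) :=
  fun u v => (`|u.1 - v.1| + `|u.2 - v.2| == 1)%N.

(* Rows and columns are indexed by the enumeration of the vertex type. *)
Definition adjmx (R : nzRingType) (V : finType) (e : rel V) : 'M[R]_#|V| :=
  \matrix_(i, j) (e (enum_val i) (enum_val j))%:R.

Definition grid_nullity (n : nat) : nat :=
  \dim (lker (linfun
    (mulmx (adjmx 'F_2 (@grid_adj n) + 1%:M) : 'cV['F_2]__ -> 'cV['F_2]__))).

(* Valued in [int] because subtraction on [nat] is truncated. *)
Definition grid_delta (n : nat) : int :=
  (grid_nullity (2 * n + 1))%:Z - 2 * (grid_nullity n)%:Z.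

(* Main.v *)
From HB Require Import structures.
Require Import Defs.
From mathcomp Require Import all_boot all_order all_algebra.
From mathcomp Require Import zify ring.

Set Implicit Arguments.
Unset Strict Implicit.
Unset Printing Implicit Defensive.

Import GRing.Theory.
Local Open Scope ring_scope.

(** Read a vector on the vertices of the grid as an n x n matrix Y, and let P
    be the adjacency matrix of the path on n vertices.  The grid is the
    Cartesian product of two paths, so that A acts by Y |-> P Y + Y P, and over
    F_2 the kernel of A + I consists of the Y with P Y = Y (P + 1).

    The rows of such a Y satisfy a three-term recurrence: with U_0 = 0, U_1 = 1
    and U_(k+2) = X U_(k+1) - U_k, the k-th row (counted from 1) is
    r U_k(P + 1), where r is the first row; the missing row n + 1 imposes the
    single condition r U_(n+1)(P + 1) = 0.  So d_n is the nullity of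
    U_(n+1)(P + 1).  The same recurrence, applied to the identity matrix, shows
    that the first basis vector is cyclic for P with annihilator U_(n+1); hence
    row vectors form the module F_2[X]/(U_(n+1)), on which P acts as X, and
    d_n = deg gcd(U_(n+1)(X), U_(n+1)(X + 1)) ([grid_nullityE]).

    Put m = n + 1 and f = U_m, g = f(X + 1).  In characteristic 2,
    U_(2m) = X f^2 ([cheb_double]), so d_(2n+1) is the degree of
    gcd(X f^2, (X + 1) g^2).  Only the irreducible factors X and X + 1 can
    contribute more than twice their multiplicity in gcd(f, g); each contributes
    one more exactly when the multiplicity of 0 as a root of f is smaller than
    that of 1 ([size_gcdp_mul_sqr]; substituting X + 1 exchanges 0 and 1).

    It remains to compare these two multiplicities, a(m) and b(m)
    ([mup_cheb]).  For odd m, a(m) = 0, while U_m(1) = 0 exactly when 3 divides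
    m since U_(k+3)(1) = - U_k(1).  Passing from m to 2m replaces (a, b) by
    (2 a + 1, 2 b), which preserves the truth of a < b, as it does that of
    3 | m. *)

(** * The Chebyshev recurrence *)

(** U_(k-1)(X / 2) for U the Chebyshev polynomials of the second kind.  The
    index is shifted so that doubling m gives U_(2m) = X U_m^2 in
    characteristic 2, and so that [cheb K k] has size k. *)
Fixpoint cheb (R : nzRingType) (k : nat) : {poly R} :=
  match k with
  | 0 => 0
  | k'.+1 => if k' is k''.+1 then 'X * cheb R k' - cheb R k'' else 1
  end.

Lemma chebSS (R : nzRingType) k :
  cheb R k.+2 = 'X * cheb R k.+1 - cheb R k.
Proof. by []. Qed.

Lemma size_cheb (K : fieldType) k : size (cheb K k) = k.
Proof.
suff: size (cheb K k) = k /\ size (cheb K k.+1) = k.+1 by case.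
elim: k => [|k [IH1 IH2]]; first by rewrite /= size_poly0 size_poly1.
have nz : cheb K k.+1 != 0 by rewrite -size_poly_gt0 IH2.
split=> //; rewrite chebSS mulrC size_polyDl size_mulX ?IH2 //.
by rewrite size_polyN IH1.
Qed.

Lemma cheb_neq0 (K : fieldType) k : (0 < k)%N -> cheb K k != 0.
Proof. by rewrite -size_poly_gt0 size_cheb. Qed.

(** Both sides satisfy the defining recurrence in m; the induction carries two
    consecutive instances. *)
Lemma chebD (R : comNzRingType) m k :
  cheb R (m + k).+1 = cheb R m.+1 * cheb R k.+1 - cheb R m * cheb R k.
Proof.
suff: cheb R (m + k).+1 = cheb R m.+1 * cheb R k.+1 - cheb R m * cheb R k
   /\ cheb R (m + k).+2 = cheb R m.+2 * cheb R k.+1 - cheb R m.+1 * cheb R k.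
  by case.
elim: m => [|m [IH1 IH2]].
  by split; rewrite add0n ?chebSS /=; ring.
split; rewrite addSn // chebSS IH1 IH2 !chebSS; ring.
Qed.

Lemma cheb_double (R : comNzRingType) m : 2 \in [pchar R] ->
  cheb R (m + m) = 'X * cheb R m ^+ 2.
Proof.
move=> R2; case: m => [|m]; first by rewrite /= expr0n mulr0.
have P2 : 2 \in [pchar {poly R}] by rewrite pchar_poly.
rewrite addnS chebD chebSS.
have -> : ('X * cheb R m.+1 - cheb R m) * cheb R m.+1 -
    cheb R m.+1 * cheb R m = 'X * cheb R m.+1 ^+ 2 -
    (cheb R m.+1 * cheb R m + cheb R m.+1 * cheb R m) by ring.
by rewrite (addrr_pchar2 P2) subr0.
Qed.

(** * Degrees of greatest common divisors *)

(** A common prime factor of p r and q s divides exactly one of p, r and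
    exactly one of q, s, and coprimality leaves only the two crossed pairs. *)
Lemma gcdp_mul_coprime (K : fieldType) (p q r s : {poly K}) :
    p != 0 -> coprimep p q -> coprimep r s ->
  gcdp (p * r) (q * s) %= gcdp p s * gcdp r q.
Proof.
move=> p0 pq rs; set e := gcdp p s.
have e0 : e != 0 by rewrite gcdp_eq0 (negPf p0).
have pE : p %/ e * e = p by rewrite divpK ?dvdp_gcdl.
have sE : s %/ e * e = s by rewrite divpK ?dvdp_gcdr.
have ps : coprimep (p %/ e) (s %/ e) by rewrite coprimep_div_gcd ?p0.
have p'q : coprimep (p %/ e) q.
  by apply: coprimep_dvdr pq; rewrite -{2}pE dvdp_mulr.
have rs' : coprimep r (s %/ e).
  by apply: coprimep_dvdl rs; rewrite -{2}sE dvdp_mulr.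
(* After cancelling e, the factor p %/ e is coprime to the whole other side. *)
rewrite -{1}pE -{1}sE mulrAC mulrA.
apply: eqp_trans (gcdp_mul2r _ _ _) _.
rewrite mulrC eqp_mul2l //.
apply: (@eqp_trans _ (gcdp r (q * (s %/ e)))).
  apply: eqp_trans (gcdpC _ _) _.
  apply: (eqp_trans _ (gcdpC _ _)); apply: Gauss_gcdpr.
  by rewrite coprimep_sym coprimepMr p'q ps.
exact: Gauss_gcdpl.
Qed.

Lemma size_gcdp_XsubC (K : fieldType) (a : K) p :
  (size (gcdp ('X - a%:P) p)).-1 = root p a.
Proof.
case: (boolP (root p a)) => [pa|].
  suff /eqp_size-> : gcdp ('X - a%:P) p %= 'X - a%:P by rewrite size_XsubC.
  by rewrite dvdp_gcd_idl // dvdp_XsubCl.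
by rewrite -coprimep_XsubC coprimep_sym => /coprimep_size_gcd->.
Qed.

(** The coprime cofactors p and q have at most one of them vanishing at a, so
    q vanishes there as soon as it has the larger multiplicity. *)
Lemma root_cofactor_mup (K : fieldType) (a : K) (d p q : {poly K}) :
    d != 0 -> p != 0 -> q != 0 -> coprimep p q ->
  root q a = (mup a (p * d) < mup a (q * d))%N.
Proof.
move=> d0 p0 q0 pq; rewrite !mupM // ltn_add2r.
case: (boolP (root q a)) => [qa|/mupNroot->]; last by rewrite ltn0.
have pa : ~~ root p a.
  by apply/negP=> /(coprimep_root pq); rewrite -rootE qa.
by rewrite (mupNroot pa) -XsubC_dvd ?dvdp_XsubCl.
Qed.

Lemma pred_size_mul (K : fieldType) (p q : {poly K}) : p != 0 -> q != 0 ->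
  (size (p * q)).-1 = ((size p).-1 + (size q).-1)%N.
Proof.
move=> p0 q0; rewrite size_mul //; move: p0 q0; rewrite -!size_poly_gt0.
by case: (size p) (size q) => [|i] [|j] //= _ _; rewrite addnS.
Qed.

(** After division by the square of the gcd of p and q there remain coprime
    squares u^2 and w^2, times X - a and X - b; by [gcdp_mul_coprime] the gcd is
    then gcd(X - a, w^2) gcd(u^2, X - b), each factor of degree at most 1. *)
Lemma size_gcdp_mul_sqr (K : fieldType) (a b : K) (p q : {poly K}) :
    a != b -> p != 0 -> q != 0 ->
  (size (gcdp (('X - a%:P) * p ^+ 2) (('X - b%:P) * q ^+ 2))).-1 =
  (2 * (size (gcdp p q)).-1 + ((mup a p < mup a q) + (mup b q < mup b p)))%N.
Proof.
move=> ab p0 q0; set d := gcdp p q.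
have d0 : d != 0 by rewrite gcdp_eq0 (negPf p0).
have pE : p %/ d * d = p by rewrite divpK ?dvdp_gcdl.
have qE : q %/ d * d = q by rewrite divpK ?dvdp_gcdr.
have cop : coprimep (p %/ d) (q %/ d) by rewrite coprimep_div_gcd ?p0.
have u0 : p %/ d != 0 by apply: contraNneq p0 => u0; rewrite -pE u0 mul0r.
have w0 : q %/ d != 0 by apply: contraNneq q0 => w0; rewrite -qE w0 mul0r.
move: (p %/ d) (q %/ d) pE qE cop u0 w0 => u w pE qE cop u0 w0.
have -> : (mup a p < mup a q)%N = root w a.
  by rewrite -pE -qE -root_cofactor_mup.
have -> : (mup b q < mup b p)%N = root u b.
  by rewrite -pE -qE -root_cofactor_mup 1?coprimep_sym.
rewrite -pE -qE !exprMn (mulrA _ (u ^+ 2)) (mulrA _ (w ^+ 2)).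
rewrite (eqp_size (gcdp_mul2r _ _ _)).
have e0 : gcdp (('X - a%:P) * u ^+ 2) (('X - b%:P) * w ^+ 2) != 0.
  by rewrite gcdp_eq0 negb_and mulf_neq0 ?polyXsubC_eq0 ?expf_neq0.
rewrite pred_size_mul ?expf_neq0 // size_exp.
have cab : coprimep ('X - a%:P) ('X - b%:P).
  by rewrite coprimep_XsubC root_XsubC eq_sym.
have cuw : coprimep (u ^+ 2) (w ^+ 2) by rewrite coprimep_expl ?coprimep_expr.
have E := gcdp_mul_coprime (negbT (polyXsubC_eq0 a)) cab cuw.
rewrite (eqp_size E) pred_size_mul; last 2 first.
- by rewrite gcdp_eq0 polyXsubC_eq0.
- by rewrite gcdp_eq0 expf_eq0 (negPf u0).
rewrite size_gcdp_XsubC (eqp_size (gcdpC _ _)) size_gcdp_XsubC.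
by rewrite !rootE !horner_exp !expf_eq0 /= addnC [(_ * 2)%N]mulnC.
Qed.

(** One inequality is substitution in a divisibility; the other is the same
    inequality for the inverse shift. *)
Lemma mup_comp_shift (K : fieldType) (a c : K) p : p != 0 ->
  mup a (p \Po ('X + c%:P)) = mup (a + c) p.
Proof.
have nz (q : {poly K}) b : q != 0 -> q \Po ('X + b%:P) != 0.
  rewrite -!size_poly_gt0 => q0.
  by rewrite size_comp_poly2 ?size_XaddC.
have le (q : {poly K}) x b :
    q != 0 -> (mup (x + b)%R q <= mup x (q \Po ('X + b%:P)))%N.
  move=> q0; rewrite mup_geq ?nz //.
  have -> : 'X - x%:P = ('X - (x + b)%:P) \Po ('X + b%:P).
    by rewrite comp_polyB comp_polyX comp_polyC polyCD; ring.
  by rewrite -rmorphXn dvdp_comp_poly // -mup_geq.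
move=> p0; apply/eqP; rewrite eqn_leq (le p a c p0) andbT.
have := le (p \Po _) (a + c) (- c) (nz p c p0).
rewrite addrK -comp_polyA comp_polyD comp_polyX comp_polyC.
by rewrite polyCN subrK comp_polyXr.
Qed.

(** * The roots 0 and 1 of the Chebyshev polynomials *)

Lemma root_cheb0 (R : comNzRingType) m : root (cheb R m) 0 = ~~ odd m.
Proof.
suff: root (cheb R m) 0 = ~~ odd m /\ root (cheb R m.+1) 0 = odd m by case.
elim: m => [|m [IH1 IH2]]; first by rewrite /= root0 (negPf (root1 _)).
split; first by rewrite IH2 /= negbK.
rewrite [odd _]/= -IH1 !rootE chebSS.
by rewrite hornerD hornerN hornerM hornerX mul0r add0r oppr_eq0.
Qed.

Lemma root_cheb1 (R : comNzRingType) m : root (cheb R m) 1 = (3 %| m)%N.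
Proof.
(* At X = 1 the recurrence gives U_(k+3) = U_(k+2) - U_(k+1) = - U_k. *)
have per k : root (cheb R k.+3) 1 = root (cheb R k) 1.
  rewrite !rootE !chebSS !(hornerD, hornerN, hornerM, hornerX) !mul1r.
  by rewrite addrAC subrr add0r oppr_eq0.
elim/ltn_ind: m => -[|[|[|m]]] IH; rewrite ?root0 ?(negPf (root1 _)) //.
  by rewrite /= subr0 mulr1 rootX oner_eq0.
have m3 : (m < m.+3)%N by rewrite ltnS !leqW.
by rewrite per (IH m m3) -[m.+3]addn3 dvdn_addl.
Qed.

(** Strong induction through m = 2h: the multiplicities a, b of the roots 0 and
    1 become 2 a + 1 and 2 b, and a < b iff 2 a + 1 < 2 b.  For odd m the root 0
    is absent and the root 1 decides. *)
Lemma mup_cheb (K : fieldType) m : 2 \in [pchar K] -> (0 < m)%N ->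
  (mup 0 (cheb K m) < mup 1 (cheb K m))%N = (3 %| m)%N.
Proof.
move=> K2; elim/ltn_ind: m => m IH m0.
case: (boolP (odd m)) => modd.
  rewrite mupNroot ?root_cheb0 ?modd // -XsubC_dvd ?cheb_neq0 //.
  by rewrite dvdp_XsubCl root_cheb1.
have mE : m = (m./2 + m./2)%N by rewrite addnn even_halfK.
set h := m./2 in mE; have h0 : (0 < h)%N by lia.
have c0 := cheb_neq0 K h0.
have -> : (3 %| m)%N = (3 %| h)%N by rewrite mE addnn -muln2 Gauss_dvdl.
rewrite -(IH h) //; last by lia.
rewrite mE cheb_double // expr2 !mupM ?mulf_neq0 ?polyX_eq0 //.
have -> : mup 0 ('X : {poly K}) = 1%N.
  by have := mup_XsubCX 1 (0 : K) 0; rewrite subr0 expr1 eqxx.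
have -> : mup 1 ('X : {poly K}) = 0%N by rewrite mupNroot // rootX oner_eq0.
move: (mup 0 _) (mup 1 _) => i j; lia.
Qed.

(** * Nullity of a polynomial in a cyclic matrix *)

(** The cyclic vector u identifies the row vectors with K[X]/(f), where A acts
    as X.  There the kernel of multiplication by g consists of the multiples of
    h = f / gcd(f, g), a space of dimension deg f - deg h. *)
Lemma nullity_horner_cyclic (K : fieldType) n (A : 'M[K]_n.+1)
    (u : 'rV_n.+1) (f g : {poly K}) :
    size f = n.+2 -> u *m horner_mx A f = 0 ->
    (forall v, exists p, v = u *m horner_mx A p) ->
  \rank (kermx (horner_mx A g)) = (size (gcdp f g)).-1.
Proof.
move=> sf uf cyc.
have f0 : f != 0 by rewrite -size_poly_gt0 sf.
have evM p q : u *m horner_mx A p *m horner_mx A q = u *m horner_mx A (p * q).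
  by rewrite -mulmxA rmorphM.
have ev_dvd p : f %| p -> u *m horner_mx A p = 0.
  by move=> /dvdpP[q ->]; rewrite mulrC -evM uf mul0mx.
have ev_mod p : u *m horner_mx A p = u *m horner_mx A (p %% f).
  rewrite {1}(divp_eq p f) rmorphD mulmxDr.
  by rewrite (ev_dvd (p %/ f * f)) ?dvdp_mull // add0r.
have ev0 p : (u *m horner_mx A p == 0) = (f %| p).
  apply/eqP/idP; last exact: ev_dvd.
  rewrite ev_mod => evp0.
  (* Evaluation of polynomials of size at most n.+1 at u is surjective between
     spaces of equal dimension, hence injective. *)
  pose E : 'M[K]_n.+1 := lin1_mx (mulmx u \o horner_mx A \o rVpoly).
  have smod : (size (p %% f)%R <= n.+1)%N by rewrite -ltnS -sf ltn_modp.
  have Efree : row_free E.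
    rewrite row_free_unit -row_full_unit -sub1mx.
    apply/row_subP=> i; have [q ->] := cyc (row i 1%:M).
    apply/submxP; exists (poly_rV (q %% f)).
    by rewrite mul_rV_lin1 /= poly_rV_K -?ev_mod // -ltnS -sf ltn_modp.
  have : poly_rV (p %% f) *m E = 0 by rewrite mul_rV_lin1 /= poly_rV_K.
  move/eqP; rewrite mulmx_free_eq0 // => /eqP /(congr1 rVpoly).
  by rewrite poly_rV_K // linear0 /dvdp => ->.
set e := gcdp f g; set d := (size e).-1; pose h := f %/ e.
have e0 : e != 0 by rewrite gcdp_eq0 (negPf f0).
have fE : h * e = f by rewrite divpK ?dvdp_gcdl.
have h0 : h != 0 by apply: contraNneq f0 => h0; rewrite -fE h0 mul0r.
have gE : g %/ e * e = g by rewrite divpK ?dvdp_gcdr.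
have f_dvd p : (f %| p * g) = (h %| p).
  rewrite -{1}fE -{1}gE mulrA dvdp_mul2r // Gauss_dvdpl //.
  by rewrite coprimep_div_gcd ?f0.
(* The rows of B are u h(A) A^i for i < d; they form a basis of the kernel. *)
pose B : 'M[K]_(d, n.+1) :=
  lin1_mx (mulmx (u *m horner_mx A h) \o horner_mx A \o rVpoly).
have BE v : v *m B = u *m horner_mx A (h * rVpoly v).
  by rewrite mul_rV_lin1 /= evM.
have sh : size f = (size h + d)%N.
  rewrite -fE size_mul // /d; have : (0 < size e)%N by rewrite size_poly_gt0.
  by case: (size e) => // k _; rewrite addnS.
have Bfree : row_free B.
  apply: inj_row_free => v; rewrite BE => /eqP; rewrite ev0 -fE.
  rewrite dvdp_mul2l // => /dvdp_leq sv.
  apply/eqP; rewrite -(inj_eq (can_inj rVpolyK)) linear0.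
  apply/negPn/negP=> /sv.
  rewrite leqNgt => /negP[]; rewrite (leq_ltn_trans (size_poly _ _)) //.
  by rewrite /d prednK ?size_poly_gt0.
rewrite -(eqP Bfree); apply/esym/eqmx_rank/andP; split.
  apply/row_subP=> i; rewrite rowE BE; apply/sub_kermxP/eqP.
  by rewrite evM ev0 f_dvd dvdp_mulr.
apply/row_subP=> i; have [p pE] := cyc (row i (kermx (horner_mx A g))).
have: row i (kermx (horner_mx A g)) *m horner_mx A g = 0.
  by apply/sub_kermxP; rewrite row_sub.
rewrite {}pE ev_mod => /eqP; rewrite evM ev0 f_dvd => /dvdpP[q qE].
apply/submxP; exists (poly_rV q); rewrite BE poly_rV_K ?[h * _]mulrC -?qE //.
have [->|q0] := eqVneq q 0; first by rewrite size_poly0.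
have : (size (p %% f)%R < size f)%N by rewrite ltn_modp.
rewrite qE size_mul // sh; have : (0 < size h)%N by rewrite size_poly_gt0.
by case: (size h) => // k _; rewrite addnS addSn /= addnC ltnS leq_add2l.
Qed.

(** * Matrices intertwining a path *)

Definition path_mx (R : nzRingType) n : 'M[R]_n :=
  \matrix_(i, j) (`|i - j| == 1)%N%:R.

(** Rows are numbered from 1 and padded by zero on both sides, so that the
    boundary of the path needs no separate case and the numbering agrees with
    that of [cheb]. *)
Definition padded_row (R : nzRingType) m n (Y : 'M[R]_(m, n)) k : 'rV_n :=
  if k is k'.+1 then oapp (fun i => row i Y) 0 (insub k') else 0.

Lemma padded_row_ord (R : nzRingType) m n (Y : 'M[R]_(m, n)) (i : 'I_m) :
  padded_row Y i.+1 = row i Y.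
Proof. by rewrite /padded_row valK. Qed.

Lemma padded_row_max (R : nzRingType) m n (Y : 'M[R]_(m, n)) : padded_row Y m.+1 = 0.
Proof. by rewrite /padded_row insubN // ltnn. Qed.

Lemma sum_padded_row (R : nzRingType) m n (Y : 'M[R]_(m, n)) k :
  \sum_(j < m) (j.+1 == k)%:R *: row j Y = padded_row Y k.
Proof.
case: k => [|k]; first by rewrite big1 // => j _; rewrite scale0r.
rewrite /padded_row; case: insubP => [i _ <-|/=].
  rewrite (bigD1 i) //= eqxx scale1r big1 ?addr0 // => j /negPf ji.
  by rewrite eqSS (inj_eq val_inj) ji scale0r.
rewrite -leqNgt => mk; rewrite big1 // => j _.
by rewrite eqSS ltn_eqF ?scale0r // (leq_trans (ltn_ord j)).
Qed.

Lemma row_path_mul (R : nzRingType) m n (Y : 'M[R]_(m, n)) (i : 'I_m) :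
  row i (path_mx R m *m Y) = padded_row Y i + padded_row Y i.+2.
Proof.
rewrite row_mul mulmx_sum_row -!sum_padded_row -big_split /=; apply: eq_bigr => j _.
rewrite !mxE -scalerDl -natrD; congr (_%:R *: _).
by lia.
Qed.

Lemma horner_mx_chebSS (R : comNzRingType) n (Q : 'M[R]_n.+1) k :
  horner_mx Q (cheb R k.+2) =
  horner_mx Q (cheb R k.+1) *m Q - horner_mx Q (cheb R k).
Proof. by rewrite chebSS rmorphB mulrC rmorphM /= horner_mx_X. Qed.

(** Row k of P Y = Y Q expresses row k + 1 through rows k and k - 1, which is
    the recurrence of [cheb] with Q in place of X. *)
Lemma padded_row_intertwiner (K : fieldType) m n (Y : 'M[K]_(m, n.+1)) Q k :
    path_mx K m *m Y = Y *m Q -> (k <= m.+1)%N ->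
  padded_row Y k = padded_row Y 1 *m horner_mx Q (cheb K k).
Proof.
move=> YQ.
suff: ((k <= m.+1)%N -> padded_row Y k = padded_row Y 1 *m horner_mx Q (cheb K k)) /\
      ((k < m.+1)%N -> padded_row Y k.+1 = padded_row Y 1 *m horner_mx Q (cheb K k.+1)).
  by case.
elim: k => [|k [IH1 IH2]].
  by split; rewrite ?rmorph0 ?mulmx0 // rmorph1 mulmx1.
split=> // km; have k1 := ltnW km; have k0 := ltnW k1.
rewrite horner_mx_chebSS mulmxBr mulmxA -(IH1 k0) -(IH2 k1).
have := row_path_mul Y (Ordinal (km : (k < m)%N)); rewrite YQ row_mul.
by rewrite -padded_row_ord /= => ->; rewrite addrC addKr.
Qed.

(** Conversely, the recurrence gives every row of P Y = Y Q, provided that it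
    produces zero in the position after the last row. *)
Lemma path_intertwiner_rows (K : fieldType) m n (r : 'rV[K]_n.+1) Q :
    r *m horner_mx Q (cheb K m.+1) = 0 ->
  let Y := \matrix_(i < m) (r *m horner_mx Q (cheb K i.+1)) in
  path_mx K m *m Y = Y *m Q.
Proof.
move=> rQ Y.
have YE k : (k <= m.+1)%N -> padded_row Y k = r *m horner_mx Q (cheb K k).
  case: k => [_|k]; first by rewrite rmorph0 mulmx0.
  rewrite ltnS leq_eqVlt => /predU1P[->|km]; first by rewrite padded_row_max rQ.
  by rewrite (padded_row_ord Y (Ordinal km)) rowK.
apply/row_matrixP=> i; rewrite row_path_mul row_mul rowK !YE ?ltnS //; last first.
- by rewrite ltnW // ltnS ltnW.
by rewrite horner_mx_chebSS mulmxBr mulmxA addrC subrK.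
Qed.

(* Simplification would unfold [cheb] and [padded_row] at successors, which
   hides them from rewriting. *)
Arguments cheb : simpl never.
Arguments padded_row : simpl never.

(** The identity matrix intertwines P with itself, so e_k = e_1 U_k(P): hence
    e_1 is a cyclic vector, and U_(n+1)(P) kills it. *)
Lemma path_nullity (K : fieldType) n (g : {poly K}) :
  \rank (kermx (horner_mx (path_mx K n.+1) g)) =
  (size (gcdp (cheb K n.+2) g)).-1.
Proof.
have E k : (k <= n.+2)%N -> padded_row 1%:M k =
    padded_row 1%:M 1 *m horner_mx (path_mx K n.+1) (cheb K k).
  by apply: padded_row_intertwiner; rewrite mulmx1 mul1mx.
apply: (@nullity_horner_cyclic _ _ _ (padded_row 1%:M 1)) => [||v].
- exact: size_cheb.
- by rewrite -E // padded_row_max.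
exists (\sum_i v 0 i *: cheb K i.+1).
rewrite {1}[v]row_sum_delta raddf_sum mulmx_sumr; apply: eq_bigr => i _.
rewrite /= horner_mxZ -scalemxAr -E; last by rewrite ltnS ltnW.
by rewrite padded_row_ord row1.
Qed.

(** * The kernel of the grid *)

Lemma dim_lker_param (K : fieldType) (aT rT sT : vectType K)
    (psi : {linear aT -> rT}) (phi : {linear rT -> sT}) :
    injective psi -> (forall y, phi y = 0 <-> exists x, y = psi x) ->
  \dim (lker (linfun phi)) = dim aT.
Proof.
move=> inj ker.
have -> : lker (linfun phi) = limg (linfun psi).
  apply/vspaceP=> y; rewrite memv_ker lfunE.
  apply/eqP/memv_imgP => [/ker[x ->]|[x _ ->]].
    by exists x; rewrite ?memvf ?lfunE.
  by apply/ker; exists x; rewrite lfunE.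
rewrite limg_dim_eq ?dimvf //; apply/eqP; rewrite capfv.
by apply/lker0P=> x y; rewrite !lfunE => /inj.
Qed.

Definition unvec_grid (K : fieldType) n (x : 'cV[K]_#|{: 'I_n * 'I_n}|) :
    'M[K]_n :=
  \matrix_(i, j) x (enum_rank (i, j)) 0.

Definition vec_grid (K : fieldType) n (Y : 'M[K]_n) :
    'cV[K]_#|{: 'I_n * 'I_n}| :=
  \col_k Y (enum_val k).1 (enum_val k).2.

Lemma unvec_gridK (K : fieldType) n :
  cancel (@unvec_grid K n) (@vec_grid K n).
Proof.
by move=> x; apply/colP=> k; rewrite !mxE -surjective_pairing enum_valK.
Qed.

Lemma vec_gridK (K : fieldType) n :
  cancel (@vec_grid K n) (@unvec_grid K n).
Proof. by move=> Y; apply/matrixP=> i j; rewrite !mxE enum_rankK. Qed.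

(** A neighbour of (i, j) differs from it by one step in exactly one coordinate,
    so that the sum over neighbours splits into a column and a row part. *)
Lemma grid_mulmxE (K : fieldType) n (x : 'cV[K]_#|{: 'I_n * 'I_n}|) :
  unvec_grid ((adjmx K (@grid_adj n) + 1%:M) *m x) =
  path_mx K n *m unvec_grid x + unvec_grid x *m path_mx K n + unvec_grid x.
Proof.
apply/matrixP=> i j; rewrite mulmxDl mul1mx !mxE; congr (_ + _).
under eq_bigr => k _ do rewrite mxE enum_rankK.
rewrite (reindex (@enum_rank {: 'I_n * 'I_n})) /=; last exact: onW_bij (@enum_rank_bij _).
under eq_bigr => k _ do rewrite enum_rankK.
under [X in _ = X + _]eq_bigr => k _ do rewrite !mxE.
under [X in _ = _ + X]eq_bigr => k _ do rewrite !mxE.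
have adjE (k : 'I_n * 'I_n) : (grid_adj (i, j) k)%:R =
    (`|i - k.1| == 1)%N%:R * (k.2 == j)%:R +
    (k.1 == i)%:R * (`|k.2 - j| == 1)%N%:R :> K.
  rewrite -!natrM -natrD -!(inj_eq val_inj) /grid_adj /=.
  by congr (_%:R); case: k => k l /=; lia.
under eq_bigr => k _ do rewrite adjE mulrDl.
rewrite big_split /=; congr (_ + _).
  transitivity (\sum_(k < n) \sum_(l < n)
      (`|i - k| == 1)%N%:R * (l == j)%:R * x (enum_rank (k, l)) 0).
    by rewrite pair_bigA /=; apply: eq_bigr => -[].
  apply: eq_bigr => k _; rewrite (bigD1 j) //= eqxx mulr1 big1 ?addr0 //.
  by move=> l /negPf->; rewrite mulr0 mul0r.
transitivity (\sum_(k < n) \sum_(l < n)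
    (k == i)%:R * (`|l - j| == 1)%N%:R * x (enum_rank (k, l)) 0).
  by rewrite pair_bigA /=; apply: eq_bigr => -[].
rewrite (bigD1 i) //= [X in _ + X]big1 ?addr0.
  by apply: eq_bigr => l _; rewrite eqxx mul1r mulrC.
by move=> k /negPf->; rewrite big1 // => l _; rewrite !mul0r.
Qed.

Lemma horner_mx_comp (R : comNzRingType) n (A : 'M[R]_n.+1) (p q : {poly R}) :
  horner_mx A (p \Po q) = horner_mx (horner_mx A q) p.
Proof.
elim/poly_ind: p => [|p c IH]; first by rewrite comp_poly0 !rmorph0.
rewrite comp_polyD comp_polyM comp_polyX comp_polyC.
by rewrite !(rmorphD, rmorphM) /= IH !horner_mx_C horner_mx_X.
Qed.

(** The kernel is parametrized by the admissible first rows r, those with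
    r U_(n+1)(P + 1) = 0: each determines the remaining rows. *)
Lemma grid_nullityE n : (0 < n)%N -> grid_nullity n =
  (size (gcdp (cheb 'F_2 n.+1) (cheb 'F_2 n.+1 \Po ('X + 1%:P)))).-1.
Proof.
case: n => // n _; set f := cheb _ _.
set P := path_mx 'F_2 n.+1; pose Q := horner_mx P ('X + 1%:P).
have QE : Q = P + 1%:M by rewrite /Q rmorphD /= horner_mx_X horner_mx_C.
rewrite -path_nullity horner_mx_comp -/P -/Q.
set B := row_base (kermx (horner_mx Q f)).
have kerB (r : 'rV_n.+1) :
    reflect (exists v, r = v *m B) (r *m horner_mx Q f == 0).
  have -> : (r *m horner_mx Q f == 0) = (r <= B)%MS.
    by rewrite -sub_kermx eq_row_base.
  exact: submxP.
(* Coordinates v on the space of admissible first rows, and the matrix that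
   the recurrence builds from them. *)
pose rows v : 'M['F_2]_n.+1 :=
  \matrix_(i < n.+1) (v *m B *m horner_mx Q (cheb 'F_2 i.+1)).
pose psi v := vec_grid (rows v).
have psi_lin : linear psi.
  move=> a u v; apply/colP=> k.
  have rowsE : rows (a *: u + v) = a *: rows u + rows v.
    apply/row_matrixP=> i; rewrite linearP /= !rowK.
    by rewrite !mulmxDl -!scalemxAl.
  by rewrite /psi rowsE !mxE.
pose Psi : {linear 'rV['F_2]_(\rank (kermx (horner_mx Q f))) -> 'cV['F_2]__} :=
  HB.pack psi (GRing.isLinear.Build _ _ _ _ psi psi_lin).
rewrite /grid_nullity (@dim_lker_param _ _ _ _ Psi) ?dim_matrix ?mul1r //.
  move=> u v /(can_inj (@vec_gridK _ _)) /(congr1 (row ord0)).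
  rewrite !rowK rmorph1 !mulmx1; apply: row_free_inj.
  exact: row_base_free.
move=> x; pose Y := unvec_grid x.
have opp2 (Z : 'M['F_2]_n.+1) : - Z = Z.
  by apply/matrixP=> i j; rewrite mxE oppr_pchar2 ?pchar_Fp.
(* Signs are immaterial over F_2, so P Y + Y P + Y = 0 is P Y = Y (P + 1). *)
have kerE : (adjmx 'F_2 (@grid_adj n.+1) + 1%:M) *m x = 0 <->
    P *m Y = Y *m Q.
  rewrite QE mulmxDr mulmx1; split=> [x0|/eqP].
    have := grid_mulmxE x; rewrite x0 -/Y -/P -addrA.
    have -> : unvec_grid 0 = 0 :> 'M['F_2]_n.+1.
      by apply/matrixP=> i j; rewrite !mxE.
    by move/esym/eqP; rewrite addr_eq0 opp2 => /eqP.
  rewrite -subr_eq0 opp2 addrA -grid_mulmxE => /eqP M0.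
  rewrite -[LHS]unvec_gridK M0.
  by apply/colP=> k; rewrite !mxE.
split=> [/kerE YQ|[v xE]].
  have YE k : (k <= n.+2)%N -> padded_row Y k = padded_row Y 1 *m horner_mx Q (cheb _ k).
    exact: padded_row_intertwiner.
  have /kerB[v vE] : padded_row Y 1 *m horner_mx Q f == 0.
    by rewrite -YE // padded_row_max.
  exists v; rewrite /= /psi -[x]unvec_gridK -/Y; congr vec_grid.
  apply/row_matrixP=> i; rewrite rowK -vE -YE ?padded_row_ord //.
  by rewrite ltnS ltnW.
apply/kerE; rewrite /Y xE vec_gridK; apply: path_intertwiner_rows.
by apply/eqP/kerB; exists v.
Qed.

(** The factors X and X + 1 each contribute 1 to the excess when the root 0 of
    U_(n+1) has smaller multiplicity than the root 1: the shift by 1 exchanges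
    the two roots, so the two contributions agree. *)
Lemma grid_deltaE n : (0 < n)%N ->
  grid_delta n = (2 * (3 %| n + 1))%N.
Proof.
move=> n0; rewrite /grid_delta !grid_nullityE ?addn1 //.
have F2 : 2 \in [pchar 'F_2] by rewrite pchar_Fp.
have -> : (2 * n).+2 = (n.+1 + n.+1)%N by rewrite mul2n -addnn addnS.
rewrite cheb_double //; set f := cheb _ n.+1.
have f0 : f != 0 by rewrite cheb_neq0.
have E1 : 'X + 1%:P = 'X - 1%:P :> {poly 'F_2}.
  by rewrite -polyCN (oppr_pchar2 F2).
have E : ('X * f ^+ 2) \Po ('X + 1%:P) =
    ('X - 1%:P) * (f \Po ('X + 1%:P)) ^+ 2.
  by rewrite comp_polyM comp_polyX rmorphXn {1}E1.
rewrite E -{1}['X]subr0 size_gcdp_mul_sqr //; last first.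
  by rewrite -size_poly_gt0 size_comp_poly2 ?size_XaddC ?size_poly_gt0.
rewrite !mup_comp_shift // add0r (addrr_pchar2 F2) mup_cheb // addnn -mul2n.
by rewrite PoszD PoszM addrAC subrr add0r.
Qed.

Theorem theorem4p1 (n : nat) (hn : (0 < n)%N) :
  (grid_delta n = 2)%R <-> (3 %| n + 1)%N.
Proof. by rewrite grid_deltaE //; case: (3 %| n + 1)%N; split. Qed.
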